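(* Let $q$ be a power of an odd prime, $m\in\mathbb{F}_q[T]$ a monic square-free polynomial, and $\chi_m$ the nontrivial quadratic character modulo $m$. Assume that $\mathcal{L}(u,\chi_m)$ satisfies GSH. Then $$\delta_+^{\mu,\mathsf{nc}}(m)=\delta_-^{\mu,\mathsf{nc}}(m)=\frac12,\quad \delta_0^{\mu,\mathsf{nc}}(m)=0,$$ $$\delta_+^{\mu}(m)=\delta_-^{\mu}(m)=\frac12,\quad \delta_0^{\mu}(m)=0.$$
   Context: Let $A=\mathbb{F}_q[T]$. $\mu$ is the M\''obius function on $A$: $\mu(f)=(-1)^k$ if $f$ is square-free with $k$ distinct monic irreducible factors, and $\mu(f)=0$ if $f$ is not square-free. $\chi_m(f)=\left(\frac fm\right)$ is the nontrivial quadratic (Jacobi-symbol) character modulo $m$, equal to $0$ if $\gcd(f,m)\ne1$. For $n\ge1$ let $a_\pm^\mu(n;m)=\#\{f\in A\text{ monic}:\deg f=n,\ \mu(f)\chi_m(f)=\pm1\}$ and $A_\pm^\mu(n;m)=\sum_{k=1}^n a_\pm^\mu(k;m)$. Define $\delta_+^{\mu,\mathsf{nc}}(m)$, $\delta_0^{\mu,\mathsf{nc}}(m)$, $\delta_-^{\mu,\mathsf{nc}}(m)$ as the limits, as $n\to\infty$, of $\frac1n\#\{1\le k\le n: a_+^\mu(k;m)-a_-^\mu(k;m)\ \square\ 0\}$ with $\square$ equal to $>$, $=$, $<$ respectively, and $\delta_+^{\mu}(m)$, $\delta_0^{\mu}(m)$, $\delta_-^{\mu}(m)$ likewise with $A_\pm^\mu$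 in place of $a_\pm^\mu$. Let $M=\deg m$. $\mathcal{L}(u,\chi_m)=\sum_{f\text{ monic}}\chi_m(f)u^{\deg f}$, a polynomial, is known to factor as $\prod_{j=1}^{M'}(1-\sqrt q e^{i\theta_j}u)(1-\sqrt q e^{-i\theta_j}u)$ with $M'=(M-1)/2$ if $M$ is odd, and as $(1-u)\prod_{j=1}^{M'}(1-\sqrt q e^{i\theta_j}u)(1-\sqrt q e^{-i\theta_j}u)$ with $M'=(M-2)/2$ if $M$ is even, where $\theta_j\in\mathbb{R}$. GSH (the Grand Simplicity Hypothesis) for $\mathcal{L}(u,\chi_m)$ means that $\pi,\theta_1,\dots,\theta_{M'}$ are linearly independent over $\mathbb{Q}$.
   Formalization: The formal theorem assumes deg m ≥ 3 (so M' ≥ 1). For deg m = 1 or 2 there are no angles, GSH holds trivially and the claim fails: deg m = 1 gives a_+ − a_- = 0 for all n ≥ 1, deg m = 2 gives a_+ − a_- = 1 for all n. *)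

(* Defs.v *)
From mathcomp Require Import all_boot all_order all_algebra.
From mathcomp Require Import complex.
From mathcomp Require Import all_classical all_reals all_analysis.
Set Implicit Arguments. Unset Strict Implicit. Unset Printing Implicit Defensive.
Import Order.TTheory GRing.Theory Num.Theory.
Import numFieldNormedType.Exports.
Local Open Scope classical_set_scope.
Local Open Scope ring_scope.

Section Arithmetic.
Variable F : finFieldType.
Implicit Types f g m P : {poly F}.

(* The degree; deg 0 = 0, but it is only used at nonzero polynomials. *)
Definition deg f : nat := (size f).-1.

(* The form used in the library lemma [poly_square_freeP]; 0 is not square-free. *)
Definition squarefree f : Prop :=
  forall u : {poly F}, size u != 1 -> ~~ (u ^+ 2 %| f).

Definition monics (n : nat) : {set {poly_n.+1 F}} :=
  [set f : {poly_n.+1 F} | (polyn f \is monic) && (size (polyn f) == n.+1)].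

(* For f != 0, every divisor of f has size at most size f, so no prime factor
   is missed by letting P range over the finite type {poly_(size f) F}. *)
Definition prime_factors f : {set {poly_(size f) F}} :=
  [set P : {poly_(size f) F} |
     [&& polyn P \is monic, irreducibleb (polyn P) & polyn P %| f]].

Definition moebius f : int :=
  if `[< squarefree f >] then (-1) ^+ #|prime_factors f| else 0.

(* (f/P) for P irreducible *)
Definition legendre f P : int :=
  if P %| f then 0
  else if `[< exists g, P %| f - g ^+ 2 >] then 1 else -1.

(* The exponent of P in m, when m != 0 and P is not constant. *)
Definition multiplicity P m : nat := \max_(e < size m | P ^+ e %| m) e.

(* chi_m(f) = (f/m), for m monic. It is 0 when gcd(f, m) != 1, since then some
   prime factor of m, which has positive multiplicity, divides f. *)
Definition quad_char m f : int :=
  \prod_(P in prime_factors m)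
    legendre f (polyn P) ^+ multiplicity (polyn P) m.

(* a_+^mu(n; m) and a_-^mu(n; m) are a_mu 1 n m and a_mu (-1) n m; likewise for
   the cumulative counts A_mu. *)
Definition a_mu (s : int) (n : nat) m : nat :=
  #|[set f in monics n | moebius (polyn f) * quad_char m (polyn f) == s]|.

Definition A_mu (s : int) (n : nat) m : nat := \sum_(1 <= k < n.+1) a_mu s k m.

(* The coefficient of u^n in L(u, chi_m), viewed as a formal power series. *)
Definition Lcoef m (n : nat) : int := \sum_(f in monics n) quad_char m (polyn f).

End Arithmetic.

Section Analysis.
Variable R : realType.

Definition expi (t : R) : R[i] := (cos t +i* sin t)%C.

Definition num_angles (M : nat) : nat :=
  if odd M then ((M - 1) %/ 2)%N else ((M - 2) %/ 2)%N.

Definition Lfactored (F : finFieldType) (M : nat) (theta : seq R) : {poly R[i]} :=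
  let sq : R[i] := (Num.sqrt (#|F|%:R : R))%:C%C in
  (if odd M then 1 else 1 - 'X) *
  \prod_(t <- theta) ((1 - (sq * expi t) *: 'X) * (1 - (sq * expi (- t)) *: 'X)).

(* theta lists theta_1, ..., theta_{M'}; L(u, chi_m) is compared with its
   factorization coefficient by coefficient, in every degree. *)
Definition is_angles (F : finFieldType) (m : {poly F}) (theta : seq R) : Prop :=
  size theta = num_angles (deg m) /\
  forall n : nat, (Lcoef m n)%:~R = (Lfactored F (deg m) theta)`_n.

Definition Q_independent (s : seq R) : Prop :=
  forall c : 'I_(size s) -> rat,
    \sum_(i < size s) ratr (c i) * s`_i = 0 -> forall i, c i = 0.

(* The angles are determined up to order, sign and multiples of 2 pi, and none of
   these affects independence with pi, so the choice of theta is immaterial. *)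
Definition GSH (F : finFieldType) (m : {poly F}) : Prop :=
  exists theta : seq R, is_angles m theta /\ Q_independent (pi :: theta).

(* The limit of #{1 <= k <= n : S k} / n exists and equals d; the term n = 0 is
   irrelevant. *)
Definition has_density (S : pred nat) (d : R) : Prop :=
  (count S (iota 1 n))%:R / n%:R @[n --> \oo] --> d.

End Analysis.

(* Main.v *)
(* As chi_m is completely multiplicative, the series of mu * chi_m is 1 / L(u, chi_m).
   By partial fractions its n-th coefficient, and also the n-th partial sum, is
   sqrt q ^ n * g n where, up to o(1), g n is a combination of the exp (+- i n theta_j)
   with at least one nonzero weight, say on exp (i n theta_1). Under GSH, Kronecker's
   theorem gives two kinds of shifts. First, an s with all s theta_j close to pi:
   g (n + s) is close to - g n, so positive and negative values are equally frequent
   up to the small values of g. Second, N shifts rotating theta_1 alone, by N distinct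
   angles: at most two of the N translates of g can be small at a given n, so small
   values of g have density at most 2 / N. *)
Require Import Defs.
From mathcomp Require Import all_boot all_order all_algebra.
From mathcomp Require Import all_fingroup cyclic qfpoly.
From mathcomp Require Import complex.
From mathcomp Require Import all_classical all_reals all_analysis.
From mathcomp Require Import ring lra zify.
Set Implicit Arguments. Unset Strict Implicit. Unset Printing Implicit Defensive.
Import Order.TTheory GRing.Theory Num.Theory.
Import numFieldNormedType.Exports.
Local Open Scope ring_scope.

(** * Legendre symbols and the Moebius function *)

(** The obstacle is the region where g is small: the shift by s reverses the sign of g only up to an
    error, so it says nothing there. Smallness after rotating theta_1 by z means that p z + p' / z +
    h is small; multiplied by z this is a quadratic polynomial in z, whence the number two, and a
    single weight p away from 0 is enough. All densities come from counting inequalities with errors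
    c + e n, so no limiting distribution of g has to be constructed. In even degree the factor 1 - u
    of L amounts to a partial summation, so one statement about partial sums serves both this factor
    and the cumulative counts. *)

Lemma sqr_nonsquareM (K : finFieldType) (a b : K) :
  a != 0 -> b != 0 -> (forall x, a != x ^+ 2) -> (forall x, b != x ^+ 2) ->
  exists x, a * b = x ^+ 2.
Proof.
move=> a0 b0 na nb.
have /cyclicP[g gE] := @field_unit_group_cyclic K [set: {unit K}]%G.
have expE c : c != 0 -> exists k, c = val g ^+ k.
  move=> c0; have uc : c \is a GRing.unit by rewrite unitfE.
  have : FinRing.unit K uc \in <[g]>%g by rewrite -gE inE.
  by move=> /cycleP[k /(congr1 val)]; rewrite FinRing.val_unitX /= => ->; exists k.
have [i aE] := expE a a0; have [j bE] := expE b b0.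
(* An even exponent would make [c] a square, so nonsquares are odd powers of [g], and two odd
   exponents have an even sum. *)
have oddE c k : c = val g ^+ k -> (forall x, c != x ^+ 2) -> odd k.
  move=> -> nc; apply: contraT => /even_halfK kE.
  by have /eqP[] := nc (val g ^+ k./2); rewrite -exprM muln2 kE.
have oi := oddE a i aE na; have oj := oddE b j bE nb.
exists (val g ^+ (i + j)./2).
by rewrite -exprM muln2 even_halfK ?oddD ?oi ?oj // exprD -aE -bE.
Qed.

Section Legendre.
Variables (F : finFieldType) (P : {poly F}).
Hypotheses (P_irr : irreducible_poly P) (P_monic : P \is monic).

Let hI : monic_irreducible_poly P := (P_irr, P_monic).

(** Carrying [hI] in the type is what makes the quotient by P a field. *)
Definition residue (f : {poly F}) : {poly %/ P with hI} := in_qpoly P f.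

Lemma residueM f g : residue (f * g) = residue f * residue g.
Proof. exact: in_qpolyM. Qed.

Lemma residue_eq0 f : (residue f == 0) = (P %| f).
Proof.
rewrite -(inj_eq val_inj) /= mk_monicE // -Pdiv.IdomainMonic.modpE //.
Qed.

Lemma residueB f g : residue (f - g) = residue f - residue g.
Proof. exact: linearB. Qed.

Lemma residue_surj x : exists f, residue f = x.
Proof.
exists (polyn x); apply/val_inj => /=.
by rewrite Pdiv.CommonRing.rmodp_small // size_mk_monic.
Qed.

Lemma residue_squareP f :
  (exists g, P %| f - g ^+ 2) <-> (exists x, residue f = x ^+ 2).
Proof.
split=> [[g]|[x]].
  rewrite -residue_eq0 residueB expr2 residueM subr_eq0 => /eqP ->.
  by exists (residue g).
have [g <-] := residue_surj x => fE; exists g.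
by rewrite -residue_eq0 residueB fE !expr2 residueM subrr.
Qed.

Lemma legendreM f g : legendre (f * g) P = legendre f P * legendre g P.
Proof.
rewrite /legendre -!residue_eq0 residueM mulf_eq0.
have [//|f0] := eqVneq (residue f) 0; first by rewrite mul0r.
have [//|g0] := eqVneq (residue g) 0; first by rewrite mulr0.
have inv (K : fieldType) (x y z : K) : y != 0 -> x * y ^+ 2 = z ^+ 2 -> x = (z / y) ^+ 2.
  by move=> y0 E; rewrite expr_div_n -E mulfK // expf_eq0.
case: (@asboolP (exists h, P %| f * g - h ^+ 2)) => [/residue_squareP[z]|nfg];
  case: (@asboolP (exists h, P %| f - h ^+ 2)) => [/residue_squareP[x fE]|nf];
  case: (@asboolP (exists h, P %| g - h ^+ 2)) => [/residue_squareP[y gE]|ng];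
  rewrite ?residueM ?mulr1 ?mul1r ?mulrN1 ?opprK //.
(* The four surviving combinations are those where the signs disagree; only the last one, nonsquare
   times nonsquare, rests on the unit group being cyclic. *)
- have x0 : x != 0 by apply: contra f0; rewrite fE => /eqP ->; rewrite expf_eq0 eqxx.
  move=> fgE; case: ng; apply/residue_squareP; exists (z / x).
  by apply: inv => //; rewrite -fE mulrC.
- have y0 : y != 0 by apply: contra g0; rewrite gE => /eqP ->; rewrite expf_eq0 eqxx.
  by move=> fgE; case: nf; apply/residue_squareP; exists (z / y); apply: inv => //; rewrite -gE.
- case: nfg; apply/residue_squareP; exists (x * y).
  by rewrite residueM fE gE exprMn.
- case: nfg; apply/residue_squareP; rewrite residueM.
  apply: sqr_nonsquareM => // x; apply/eqP => E.
    by case: nf; apply/residue_squareP; exists x.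
  by case: ng; apply/residue_squareP; exists x.
Qed.

Lemma legendre1 : legendre 1 P = 1.
Proof.
rewrite /legendre dvdp1 ifF; last by have [] := P_irr; case: size => [|[]].
by case: asboolP => // -[]; exists 1; rewrite expr1n subrr dvdp0.
Qed.

End Legendre.

(** * Inverting the series of chi_m by Moebius cancellation *)

Section Moebius.
Variable F : finFieldType.
Implicit Types f g m P d : {poly F}.

Lemma quad_charM m f g : quad_char m (f * g) = quad_char m f * quad_char m g.
Proof.
rewrite /quad_char -big_split; apply: eq_bigr => P /=.
rewrite inE => /and3P[P_monic /irreducibleP P_irr _].
by rewrite legendreM // exprMn.
Qed.

Lemma quad_char1 m : quad_char m 1 = 1.
Proof.
apply: big1 => P; rewrite inE => /and3P[P_monic /irreducibleP P_irr _].
by rewrite legendre1 // expr1n.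
Qed.

Definition is_sign (x : int) := [|| x == 0, x == 1 | x == -1].

Lemma is_signM x y : is_sign x -> is_sign y -> is_sign (x * y).
Proof. by case/or3P => /eqP -> /or3P[] /eqP ->. Qed.

Lemma is_signX x n : is_sign x -> is_sign (x ^+ n).
Proof. by move=> hx; elim: n => // n; rewrite exprS; apply: is_signM. Qed.

Lemma moebius_sign f : is_sign (moebius f).
Proof. by rewrite /moebius; case: ifP => // _; apply: is_signX. Qed.

Lemma quad_char_sign m f : is_sign (quad_char m f).
Proof.
rewrite /quad_char; elim/big_ind: _ => // [|P _]; first exact: is_signM.
by apply: is_signX; rewrite /legendre; do 2?case: ifP.
Qed.

Definition twisted_moebius_sum m n : int :=
  \sum_(f in monics F n) moebius (polyn f) * quad_char m (polyn f).

(** As mu * chi_m takes only the values 0, 1 and -1, comparing the two counts becomes a question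
    about the sign of one power series coefficient. *)
Lemma a_mu_diff n m : (a_mu 1 n m)%:Z - (a_mu (-1) n m)%:Z = twisted_moebius_sum m n.
Proof.
have natsum s : (a_mu s n m)%:Z =
    \sum_(f in monics F n) (moebius (polyn f) * quad_char m (polyn f) == s)%:Z.
  rewrite /a_mu -sum1_card -natz natr_sum big_mkcond [RHS]big_mkcond.
  apply: eq_bigr => f _; rewrite [in LHS]inE; case: (f \in _) => //=.
  by case: (_ == s).
rewrite !natsum -sumrB; apply: eq_bigr => f _.
by have /or3P[] := is_signM (moebius_sign (polyn f)) (quad_char_sign m (polyn f));
  move/eqP ->.
Qed.

Lemma monicsP n (f : {poly_n.+1 F}) :
  reflect (polyn f \is monic /\ size (polyn f) = n.+1) (f \in monics F n).
Proof. by rewrite inE; apply: (iffP andP) => [[-> /eqP]|[-> ->]]. Qed.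

Lemma monics0 : monics F 0 = [set npolyp 1 1].
Proof.
apply/setP => f; apply/monicsP/set1P => [[fm fs]|->].
  apply/val_inj; rewrite /= npolypK ?size_poly1 //.
  by have /size_poly1P[c _ fE] := introT eqP fs; move: fm; rewrite fE monicE lead_coefC => /eqP ->.
by rewrite npolypK ?size_poly1 // monic1.
Qed.

Lemma dvdp_irreducibleM Q f g : irreducible_poly Q ->
  (Q %| f * g) = (Q %| f) || (Q %| g).
Proof.
move=> Q_irr; have [Qf|nQf] := boolP (Q %| f); first by rewrite dvdp_mulr.
by rewrite Gauss_dvdpr // irreducible_poly_coprime.
Qed.

Lemma dvdp_monic_irreducible Q P : Q \is monic -> P \is monic ->
  irreducible_poly Q -> irreducible_poly P -> (Q %| P) = (Q == P).
Proof.
move=> Qm Pm [Qs _] [_ P_irr]; apply/idP/eqP => [QP|->]; last exact: dvdpp.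
by apply/eqP; rewrite -eqp_monic //; apply: P_irr; rewrite // neq_ltn Qs orbT.
Qed.

(** The type of [prime_factors f] depends on the size of f, so the prime factors of d and of P * d
    can be compared only inside a common [{poly_N F}]. *)
Definition prime_factors_in N f : {set {poly_N F}} :=
  [set P : {poly_N F} | [&& polyn P \is monic, irreducibleb (polyn P) & polyn P %| f]].

Lemma card_prime_factors_in N f : f != 0 -> (size f <= N)%N ->
  #|prime_factors_in N f| = #|prime_factors f|.
Proof.
move=> f0 fN; rewrite -(card_in_imset (f := fun P : {poly_(size f) F} => npolyp N (polyn P))).
  apply: eq_card => P; apply/idP/imsetP => [|[Q + ->]].
    rewrite inE => /and3P[Pm Pi Pf].
    have sP : (size (polyn P) <= size f)%N by exact: dvdp_leq.
    exists (npolyp (size f) (polyn P)); first by rewrite inE npolypK ?Pm ?Pi.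
    by apply/val_inj; rewrite /= !npolypK // size_npoly.
  by rewrite !inE npolypK // (leq_trans (size_npoly Q)).
move=> P Q _ _ /(congr1 val) /=; rewrite !npolypK ?(leq_trans (size_npoly _)) //.
by move=> PQ; apply/val_inj.
Qed.

(** When P divides u, u ^ 2 dividing P * d would force P to divide d; otherwise u ^ 2 is coprime to
    P and already divides d. *)
Lemma squarefreeM P d : irreducible_poly P -> ~~ (P %| d) ->
  squarefree (P * d) <-> squarefree d.
Proof.
move=> P_irr Pd; split=> sf u us; first by apply: contra (sf u us); apply: dvdp_mull.
apply/negP => uPd; have [Pu|nPu] := boolP (P %| u).
  have : P ^+ 2 %| P * d by apply: dvdp_trans uPd; apply: dvdp_exp2r.
  by rewrite expr2 dvdp_mul2l ?irredp_neq0 // (negPf Pd).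
move: uPd; rewrite Gauss_dvdpr; last first.
  by rewrite coprimep_expl // coprimep_sym irreducible_poly_coprime.
by rewrite (negPf (sf u us)).
Qed.

Lemma moebiusM P d : irreducible_poly P -> P \is monic -> d != 0 -> ~~ (P %| d) ->
  moebius (P * d) = - moebius d.
Proof.
move=> P_irr P_monic d0 Pd; rewrite /moebius.
have -> : `[< squarefree (P * d) >] = `[< squarefree d >].
  by apply/asboolP/asboolP => /(squarefreeM P_irr Pd).
case: ifP => _; last by rewrite oppr0.
have P0 := irredp_neq0 P_irr.
set N := size (P * d).
have PN : (size P <= N)%N by rewrite dvdp_leq ?mulf_neq0 ?dvdp_mulIl.
have dN : (size d <= N)%N by rewrite dvdp_leq ?mulf_neq0 ?dvdp_mulIr.
suff -> : #|prime_factors (P * d)| = #|prime_factors d|.+1 by rewrite exprS mulN1r.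
rewrite -(card_prime_factors_in (N := N)) // ?mulf_neq0 //.
rewrite -[in RHS](card_prime_factors_in (N := N)) //.
suff -> : prime_factors_in N (P * d) = npolyp N P |: prime_factors_in N d.
  by rewrite cardsU1 inE npolypK // (negPf Pd) !andbF.
apply/setP => Q; rewrite !inE.
have -> : (Q == npolyp N P) = (polyn Q == P).
  by rewrite -(inj_eq val_inj) /= npolypK.
have [Qm /=|] := boolP (polyn Q \is monic); last first.
  by rewrite /= orbF => Qm; apply/esym/negbTE; apply: contra Qm => /eqP ->.
have [Qi /=|Qi] := irreducibleP; last first.
  by rewrite /= orbF; apply/esym/negP => /eqP QP; case: Qi; rewrite QP.
by rewrite dvdp_irreducibleM // dvdp_monic_irreducible.
Qed.

Lemma exists_monic_irreducible f : (1 < size f)%N ->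
  exists P, [/\ irreducible_poly P, P \is monic & P %| f].
Proof.
have [n] := ubnP (size f); elim: n f => // n IH f fn f1.
have f0 : f != 0 by rewrite -size_poly_gt0 ltnW.
have [/irreducibleP [fs fi]|/irreducibleP nf] := boolP (irreducibleb f).
  have lc0 : (lead_coef f)^-1 != 0 by rewrite invr_eq0 lead_coef_eq0.
  exists ((lead_coef f)^-1 *: f); split.
  - split=> [|q qs]; first by rewrite size_scale.
    by rewrite dvdpZr // => /(fi _ qs)/eqp_trans -> //; rewrite eqp_sym eqp_scale.
  - by rewrite monicE lead_coefZ mulVf // lead_coef_eq0.
  - by rewrite dvdpZl.
have [g [gs gf ngf]] : exists g, [/\ size g != 1, g %| f & ~~ (g %= f)].
  apply: contrapT => nex; apply: nf; split=> // g gs gf.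
  by apply: contrapT => /negP ngf; apply: nex; exists g.
have g0 : g != 0 by apply: contraNneq f0 => g0; move: gf; rewrite g0 dvd0p.
have [||P [Pi Pm Pg]] := IH g.
- have := dvdp_size_eqp gf; have := dvdp_leq f0 gf.
  by rewrite (negPf ngf) leq_eqVlt => /orP[->//|gf' _]; apply: leq_trans gf' _.
- by move: gs; rewrite neq_ltn ltnS leqn0 size_poly_eq0 (negPf g0).
- by exists P; split=> //; apply: dvdp_trans gf.
Qed.

Lemma twisted_moebius_sum0 m : twisted_moebius_sum m 0 = 1.
Proof.
rewrite /twisted_moebius_sum monics0 big_set1 npolypK ?size_poly1 //.
rewrite quad_char1 mulr1 /moebius.
case: asboolP => [_|[]]; last first.
  move=> u us; apply: contra us => /(dvdp_trans (dvdp_exp _ (dvdpp u))) -/(_ isT).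
  by rewrite dvdp1.
rewrite (_ : prime_factors 1 = finset.set0) ?cards0 //.
apply/setP => P; rewrite !inE; apply/negP => /and3P[_ /irreducibleP[P1 _]].
by rewrite dvdp1 => /eqP P1'; rewrite P1' in P1.
Qed.

(** Moves the monics of degree n into a type that does not depend on n, so that sums over several
    degrees can be merged. *)
Lemma sum_monicsE N n (h : {poly F} -> int) : (n < N)%N ->
  \sum_(f in monics F n) h (polyn f) =
  \sum_(f : {poly_N F} | (polyn f \is monic) && (size (polyn f) == n.+1)) h (polyn f).
Proof.
move=> nN; rewrite (reindex_onto (fun f : {poly_n.+1 F} => npolyp N (polyn f))
  (fun f : {poly_N F} => npolyp n.+1 (polyn f))) /=; last first.
  by move=> f /andP[_ /eqP fs]; apply/val_inj; rewrite /= !npolypK ?npolypK ?fs.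
have npK (f : {poly_n.+1 F}) : npolyp N (polyn f) = polyn f :> {poly F}.
  by rewrite npolypK // (leq_trans (size_npoly f)).
apply: eq_big => f; last by rewrite npK.
rewrite npK [in LHS]inE; apply/esym/andb_idr => _.
by apply/eqP/val_inj; rewrite /= npolypK // size_npoly.
Qed.

Lemma sum_monics_dvd n i d (h : {poly F} -> int) : d \is monic -> size d = i.+1 ->
  (i <= n)%N ->
  \sum_(e in monics F (n - i)) h (d * polyn e) =
  \sum_(f in monics F n | d %| polyn f) h (polyn f).
Proof.
move=> dm ds ilen.
have d0 := monic_neq0 dm.
have sM (e : {poly F}) : size e = (n - i).+1 -> size (d * e) = n.+1.
  move=> es; have e0 : e != 0 by rewrite -size_poly_eq0 es.
  by rewrite size_monicM // ds es addSn addnS subnKC.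
rewrite [RHS](reindex_onto (fun e : {poly_(n - i).+1 F} => npolyp n.+1 (d * polyn e))
  (fun f : {poly_n.+1 F} => npolyp (n - i).+1 (polyn f %/ d))) /=; last first.
  move=> f /andP[/monicsP[fm fs] df]; apply/val_inj => /=.
  have qs : size (polyn f %/ d) = (n - i).+1 by rewrite size_divp // fs ds subSn.
  by rewrite [in X in d * X]npolypK ?qs // mulrC divpK // npolypK ?fs.
have npK (e : {poly_(n - i).+1 F}) :
    npolyp n.+1 (d * polyn e) = d * polyn e :> {poly F}.
  rewrite npolypK // (leq_trans (size_polyMleq _ _)) // ds addSn /=.
  by apply: leq_trans (leq_add (leqnn i) (size_npoly e)) _; rewrite addnS subnKC.
apply: eq_big => e; last by rewrite npK.
apply/monicsP/andP => [[em es]|[/andP[/monicsP[]]]]; rewrite npK.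
  split; last by apply/eqP/val_inj; rewrite /= mulKp // npolypK ?es.
  by rewrite dvdp_mulIl andbT; apply/monicsP; rewrite npK sM // monicMl.
rewrite monicMl // => em es _ _; split=> //.
move: es; rewrite size_monicM ?monic_neq0 // ds addSn /= => es.
by apply/eqP; rewrite -(eqn_add2l i) es addnS subnKC.
Qed.

(* The divisors d and dP of f (with P not dividing d) cancel in pairs. *)
Lemma sum_moebius n f : f \is monic -> size f = n.+2 ->
  \sum_(d : {poly_n.+2 F} | (polyn d \is monic) && (polyn d %| f)) moebius (polyn d) = 0.
Proof.
move=> fm fs; have f0 := monic_neq0 fm.
have [|P [Pi Pm Pf]] := @exists_monic_irreducible f; first by rewrite fs.
have P0 := irredp_neq0 Pi.
have lef (g : {poly F}) : g %| f -> (size g <= n.+2)%N by rewrite -fs; apply: dvdp_leq.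
pose h (d : {poly_n.+2 F}) : {poly_n.+2 F} :=
  npolyp _ (if P %| polyn d then polyn d %/ P else P * polyn d).
(* Square-freeness makes [h] an involution: if P ^ 2 divided d, then d / P would be sent on to d / P
   ^ 2 instead of back to d. The discarded divisors have mu = 0. *)
pose D (d : {poly_n.+2 F}) :=
  [&& polyn d \is monic, polyn d %| f & `[< squarefree (polyn d) >]].
have divD (d : {poly_n.+2 F}) : polyn d \is monic -> P %| polyn d ->
    [/\ polyn d = P * (polyn d %/ P), polyn d %/ P \is monic & polyn d %/ P %| polyn d].
  move=> dm Pd; have dE : polyn d = P * (polyn d %/ P) by rewrite mulrC divpK.
  by split=> //; [rewrite -(monicMl _ Pm) -dE | rewrite [X in _ %| X]dE dvdp_mulIr].
have hP (d : {poly_n.+2 F}) : D d -> ~~ (P %| polyn d) ->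
    polyn (h d) = P * polyn d /\ D (h d).
  move=> /and3P[dm df /asboolP dsf] nPd.
  have Pdf : P * polyn d %| f.
    by rewrite Gauss_dvdp ?Pf // irreducible_poly_coprime.
  have hE : polyn (h d) = P * polyn d.
    by rewrite /h (negPf nPd) npolypK // lef.
  by rewrite /D hE monicMl // dm Pdf; split=> //; apply/asboolP/squarefreeM.
have hN (d : {poly_n.+2 F}) : D d -> P %| polyn d ->
    [/\ polyn d = P * polyn (h d), D (h d) & ~~ (P %| polyn (h d))].
  move=> /and3P[dm df /asboolP dsf] Pd.
  have [dE em ed] := divD d dm Pd.
  have hE : polyn (h d) = polyn d %/ P.
    by rewrite /h Pd npolypK // lef // (dvdp_trans ed).
  have nP : ~~ (P %| polyn d %/ P).
    have P1 : size P != 1 by rewrite neq_ltn Pi.1 orbT.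
    apply: contra (dsf P P1) => Pd'.
    by rewrite [in X in _ %| X]dE expr2 dvdp_mul2l.
  rewrite /D !hE em (dvdp_trans ed df); split=> //.
  by apply/asboolP/(squarefreeM Pi nP); rewrite -dE.
have hD (d : {poly_n.+2 F}) : D d -> D (h d).
  by move=> Dd; have [/(hN d Dd)[]|/(hP d Dd)[]] := boolP (P %| polyn d).
have hK (d : {poly_n.+2 F}) : D d -> h (h d) = d.
  move=> Dd; apply/val_inj => /=; have [Pd|Pd] := boolP (P %| polyn d).
    by have [dE Dh nP] := hN d Dd Pd; have [-> _] := hP _ Dh nP.
  have [hE Dh] := hP d Dd Pd.
  have [|E _ _] := hN _ Dh; first by rewrite hE dvdp_mulIl.
  by apply: (mulfI P0); rewrite -E hE.
have hS (d : {poly_n.+2 F}) : D d -> moebius (polyn (h d)) = - moebius (polyn d).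
  move=> Dd; have d0 : polyn d != 0 by case/and3P: Dd => /monic_neq0.
  have [Pd|Pd] := boolP (P %| polyn d); last first.
    by have [-> _] := hP d Dd Pd; rewrite moebiusM.
  have [-> /and3P[/monic_neq0 h0 _ _] nP] := hN d Dd Pd.
  by rewrite [in RHS]moebiusM // opprK.
have -> : \sum_(d : {poly_n.+2 F} | (polyn d \is monic) && (polyn d %| f))
    moebius (polyn d) = \sum_(d | D d) moebius (polyn d).
  rewrite big_mkcond [RHS]big_mkcond; apply: eq_bigr => d _.
  by rewrite /D /moebius andbA; case: asboolP; rewrite ?andbT ?andbF //; case: ifP.
set S := \sum_(d | D d) _.
suff : S = - S by lia.
rewrite /S -sumrN (reindex_onto h h) //=.
apply: eq_big => d; last by case/andP => Dh /eqP hh; apply: hS; rewrite -hh hD.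
apply/andP/idP => [[Dh /eqP <-]|Dd]; first exact: hD.
by rewrite hK ?hD.
Qed.

(** Group the pairs (d, e) by f = d * e: complete multiplicativity takes chi_m(f) out, and the
    remaining sum of mu over the divisors of f vanishes unless f = 1. *)
Lemma Lcoef_conv m n :
  \sum_(i < n.+1) twisted_moebius_sum m i * Lcoef m (n - i) = (n == 0)%:R.
Proof.
case: n => [|n].
  rewrite big_ord1 subn0 twisted_moebius_sum0 mul1r /Lcoef monics0 big_set1.
  by rewrite npolypK ?size_poly1 // quad_char1.
have step (i : 'I_n.+2) : twisted_moebius_sum m i * Lcoef m (n.+1 - i) =
    \sum_(f in monics F n.+1) quad_char m (polyn f) *
    \sum_(d : {poly_n.+2 F} | [&& polyn d \is monic, polyn d %| polyn f &
       size (polyn d) == i.+1]) moebius (polyn d).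
  have ilt := ltn_ord i.
  rewrite /twisted_moebius_sum /Lcoef.
  rewrite (@sum_monicsE n.+2 i (fun f => moebius f * quad_char m f)) //.
  under [RHS]eq_bigr do rewrite mulr_sumr.
  rewrite mulr_suml (exchange_big_dep
    (fun d : {poly_n.+2 F} => (polyn d \is monic) && (size (polyn d) == i.+1))) /=; last first.
    by move=> f d _ /and3P[-> _ ->].
  apply: eq_bigr => d /andP[dm /eqP ds].
  rewrite mulr_sumr.
  transitivity (\sum_(e in monics F (n.+1 - i))
      moebius (polyn d) * quad_char m (polyn d * polyn e)).
    by apply: eq_bigr => e _; rewrite quad_charM mulrA.
  rewrite (sum_monics_dvd (fun f => moebius (polyn d) * quad_char m f) dm ds) //.
  apply: eq_big => [f|f _]; last exact: mulrC.
  by rewrite dm ds eqxx andbT.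
under eq_bigr do rewrite step.
rewrite exchange_big /= big1 // => f /monicsP[fm fs].
rewrite -mulr_sumr [X in _ * X](_ : _ = 0) ?mulr0 // -[RHS](sum_moebius fm fs).
(* The divisors are sorted by degree; [inord] truncates nothing, since nonzero elements of
   [{poly_n.+2 F}] have size between 1 and n.+2. *)
rewrite (partition_big (fun d : {poly_n.+2 F} => inord (size (polyn d)).-1 : 'I_n.+2) xpredT) //=.
apply: eq_bigr => i _; apply: eq_bigl => d; rewrite -andbA.
have [dm|//] := boolP (polyn d \is monic); congr (_ && _).
have ds := size_npoly d.
have : (0 < size (polyn d))%N by rewrite size_poly_gt0 monic_neq0.
case: (size (polyn d)) ds => // k kn _; rewrite /= eqSS -(inj_eq val_inj) /= inordK //.
Qed.

End Moebius.

(** * Counting and densities *)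

Section Counting.
Implicit Types (S : pred nat) (n s K : nat).

Lemma count_iota_ltn K n : (count (fun k => k < K) (iota 1 n) <= K)%N.
Proof.
rewrite -size_filter -[X in (_ <= X)%N](size_iota 0).
apply: uniq_leq_size; first by rewrite filter_uniq ?iota_uniq.
by move=> k; rewrite mem_filter [k \in iota 0 K]mem_iota => /andP[].
Qed.

Lemma count_iota_eventually S S' K n : (forall k, (K <= k)%N -> S k -> S' k) ->
  (count S (iota 1 n) <= K + count S' (iota 1 n))%N.
Proof.
move=> SS'; apply: leq_trans (_ : count (predU (fun k => k < K)%N S') (iota 1 n) <= _)%N.
  by apply: sub_count => k Sk /=; case: ltnP => //= Kk; apply: SS'.
apply: leq_trans (leq_add (count_iota_ltn K n) (leqnn _)).
by rewrite -count_predUI leq_addr.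
Qed.

Lemma count_iota_shift S s n :
  count (fun k => S (k + s)%N) (iota 1 n) = count S (iota s.+1 n).
Proof.
have -> : iota s.+1 n = map (fun k => k + s)%N (iota 1 n).
  by rewrite (eq_map (addnC^~ s)) -iotaDl addn1.
by rewrite count_map.
Qed.

Lemma count_iota_unshift S s n :
  (count S (iota 1 n) <= s + count (fun k => S (k + s)%N) (iota 1 n))%N.
Proof.
rewrite count_iota_shift.
apply: leq_trans (_ : count S (iota 1 (s + n)) <= _)%N.
  by rewrite addnC iotaD count_cat leq_addr.
rewrite iotaD count_cat add1n leq_add2r.
by apply: leq_trans (count_size _ _) _; rewrite size_iota.
Qed.

Lemma count_iota_shift_le S s n :
  (count (fun k => S (k + s)%N) (iota 1 n) <= s + count S (iota 1 n))%N.
Proof.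
rewrite count_iota_shift.
apply: leq_trans (_ : count S (iota 1 (s + n)) <= _)%N.
  by rewrite iotaD count_cat add1n leq_addl.
rewrite addnC iotaD count_cat addnC leq_add2r.
by apply: leq_trans (count_size _ _) _; rewrite size_iota.
Qed.

(* Dividing by N * n: the upper density of S is at most c / N. *)
Lemma count_iota_average S N c K n (s : 'I_N -> nat) :
  (forall k, (K <= k)%N -> (#|[pred l | S (k + s l)%N]| <= c)%N) ->
  (N * count S (iota 1 n) <= \sum_l s l + K * N + c * n)%N.
Proof.
move=> hS.
apply: (@leq_trans (\sum_l (s l + count (fun k => S (k + s l)%N) (iota 1 n))))%N.
  rewrite -[X in (X * _)%N]card_ord -sum_nat_const.
  by apply: leq_sum => l _; apply: count_iota_unshift.
rewrite big_split -addnA leq_add2l /=.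
under eq_bigr do rewrite -sum1_count big_mkcond.
rewrite exchange_big /=.
apply: (@leq_trans (\sum_(k <- iota 1 n) ((k < K) * N + c)))%N.
  apply: leq_sum => k _; rewrite -big_mkcond sum1_card.
  have [kK|Kk] := ltnP k K; last by rewrite mul0n; apply: hS.
  by rewrite mul1n; apply: leq_trans (max_card _) _; rewrite card_ord leq_addr.
rewrite big_split /= -big_distrl /= leq_add //.
  rewrite leq_mul2r; apply/orP; right; apply: leq_trans _ (count_iota_ltn K n).
  by rewrite -sum1_count [X in (_ <= X)%N]big_mkcond /= leq_sum // => k _; case: ltnP.
by rewrite big_const_seq count_predT size_iota iter_addn addn0.
Qed.

(** Shifts cost a bounded error and small values an error e * n, so this is the form in which the
    estimates arrive; once n is large, half of the tolerance absorbs c. *)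
Lemma has_density_linear (R : realType) S (d : R) :
  (forall e, 0 < e -> exists c, forall n,
     `|(count S (iota 1 n))%:R - d * n%:R| <= c + e * n%:R) ->
  has_density S d.
Proof.
move=> h; apply/cvgrPdist_le => e e0.
have [c hc] := h (e / 2) (divr_gt0 e0 (ltr0Sn R 1)).
near=> n.
have n0 : 0 < n%:R :> R by rewrite ltr0n; near: n; exact: nbhs_infty_gt.
have -> : d - (count S (iota 1 n))%:R / n%:R =
    - (((count S (iota 1 n))%:R - d * n%:R) / n%:R) by field; rewrite gt_eqF.
rewrite normrN normrM normfV (gtr0_norm n0) ler_pdivrMr //.
apply: le_trans (hc n) _.
have : c / (e / 2) <= n%:R by near: n; exact: nbhs_infty_ger.
rewrite ler_pdivrMr ?divr_gt0 //; lra.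
Unshelve. all: by end_near.
Qed.

End Counting.

(** * Kronecker's theorem and sign changes *)

Section Kronecker.
Variable R : realType.
Local Notation C := R[i].
Local Notation N := (@ComplexField.Normc.normc R).
Import ComplexField.Normc.

Lemma normc_ge0 (z : C) : 0 <= N z.
Proof. by case: z => a b; rewrite /normc sqrtr_ge0. Qed.

Lemma normcX (z : C) n : N (z ^+ n) = N z ^+ n.
Proof. by elim: n => [|n IH]; rewrite ?expr0 ?normc1 // !exprS normcM IH. Qed.

Lemma normc_opp (z : C) : N (- z) = N z.
Proof. by case: z => a b; rewrite /normc /= !sqrrN. Qed.

Lemma le_normc_add (x y : C) : N (x + y) <= N x + N y.
Proof. exact: (@le_normcD R). Qed.

Lemma normcBC (x y : C) : N (x - y) = N (y - x).
Proof. by rewrite -normc_opp opprB. Qed.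

Lemma normc_sum (I : Type) (s : seq I) (P : pred I) (f : I -> C) :
  N (\sum_(i <- s | P i) f i) <= \sum_(i <- s | P i) N (f i).
Proof.
elim/big_rec2: _ => [|i x y _ h]; first by rewrite normc0.
by apply: le_trans (le_normc_add _ _) _; rewrite lerD2l.
Qed.

Lemma normc_real (x : R) : N x%:C%C = `|x|.
Proof. by rewrite /normc /= expr0n addr0 sqrtr_sqr. Qed.

Lemma normc_gt0 (z : C) : (0 < N z) = (z != 0).
Proof.
rewrite lt_def normc_ge0 andbT; congr (~~ _).
by apply/eqP/eqP => [/eq0_normc|->] //; rewrite normc0.
Qed.

Lemma normc_geometric (z : C) n : N z = 1 -> N (z - 1) * N (\sum_(k < n) z ^+ k) <= 2.
Proof.
move=> z1; rewrite -normcM -subrX1; apply: le_trans (le_normc_add _ _) _.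
by rewrite normc_opp normcX z1 expr1n normc1.
Qed.

Lemma normc1_conj (z : C) : N z = 1 -> z^-1 = (z^*)%C.
Proof.
move=> z1; have z0 : z != 0 by rewrite -normc_gt0 z1.
apply: (mulfI z0); rewrite divff // -sqr_normc normc_def.
move: z1; rewrite /normc; case: (z) => a b /= ->.
by rewrite expr1n.
Qed.

Section Independent.
Variables (I : finType) (b : I -> C).
Hypothesis b1 : forall i, N (b i) = 1.
(** Multiplicative independence, with natural exponents on both sides in place of negative ones. In
    particular no b i is a root of unity. *)
Hypothesis b_indep : forall a c : I -> nat,
  \prod_i b i ^+ a i = \prod_i b i ^+ c i -> a =1 c.

Let b0 i : b i != 0. Proof. by rewrite -normc_gt0 b1. Qed.

(* Over k < n, a product of Laurent polynomials in the b i ^ k averages, up to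
   O(1/n), to the product of the constant terms. *)
Lemma mean_prod_laurent (T : finType) (c : I -> T -> C) (p m : T -> nat) :
  exists K : R, forall n,
  N (\sum_(k < n) \prod_i \sum_x c i x * ((b i ^+ k) ^+ p x * (b i ^+ k)^-1 ^+ m x)
     - n%:R * \prod_i \sum_(x | p x == m x) c i x) <= K.
Proof.
pose cf (f : {ffun I -> T}) := \prod_i c i (f i).
pose z (f : {ffun I -> T}) := \prod_i (b i ^+ p (f i) * (b i)^-1 ^+ m (f i)).
(* Each f in the expanded product gives a geometric sum of ratio [z f], at most 2 / |z f - 1| when
   the ratio is not 1. When it is 1, the difference is 0 and so is the bound, division by 0 giving
   0. *)
exists (\sum_f N (cf f) * (2 / N (z f - 1))) => n.
have -> : \sum_(k < n) \prod_i \sum_x c i x * ((b i ^+ k) ^+ p x * (b i ^+ k)^-1 ^+ m x) =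
    \sum_f cf f * \sum_(k < n) z f ^+ k.
  under eq_bigr do rewrite bigA_distr_bigA.
  rewrite exchange_big; apply: eq_bigr => f _; rewrite mulr_sumr.
  apply: eq_bigr => k _; rewrite big_split /= -prodrXl; congr (_ * _).
  by apply: eq_bigr => i _; rewrite exprMn -exprVn -!exprM (mulnC k (p _)) (mulnC k (m _)).
have -> : \prod_i \sum_(x | p x == m x) c i x =
    \sum_(f : {ffun I -> T}) if [forall i, p (f i) == m (f i)] then cf f else 0.
  under eq_bigr do rewrite big_mkcond.
  rewrite bigA_distr_bigA; apply: eq_bigr => f _.
  case: forallP => [h|/forallP]; first by apply: eq_bigr => i _; rewrite h.
  rewrite negb_forall => /existsP[i /negPf h].
  by rewrite (bigD1 i) //= h mul0r.
rewrite mulr_sumr -sumrB; apply: le_trans (normc_sum _ _ _) _.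
apply: ler_sum => f _.
case: forallP => [h|/forallP nh].
  have z1 : z f = 1.
    by apply: big1 => i _; rewrite (eqP (h i)) exprVn divff // expf_neq0.
  under eq_bigr do rewrite z1 expr1n.
  rewrite sumr_const card_ord mulrC subrr normc0.
  by rewrite mulr_ge0 ?divr_ge0 ?normc_ge0.
rewrite mulr0 subr0 normcM ler_wpM2l ?normc_ge0 //.
have zn1 : z f - 1 != 0.
  rewrite subr_eq0; apply: contra nh => /eqP z1; apply/forallP => i; apply/eqP.
  apply: (b_indep (a := fun i => p (f i)) (c := fun i => m (f i))).
  transitivity (z f * \prod_i b i ^+ m (f i)); last by rewrite z1 mul1r.
  rewrite /z -big_split; apply: eq_bigr => j _ /=.
  by rewrite exprVn mulfVK // expf_neq0.
have Nz : N (z f) = 1.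
  rewrite (big_morph N (@normcM R) (normc1 R)) big1 // => i _.
  by rewrite normcM !normcX normcV b1 invr1 !expr1n mulr1.
by rewrite ler_pdivlMr ?normc_gt0 // mulrC normc_geometric.
Qed.

Section Targets.
Variable t : I -> C.
Hypothesis t1 : forall i, N (t i) = 1.

(** This is D times the Fejér kernel: nonnegative, bounded independently of D away from u = 1, and
    with constant term D as a Laurent polynomial on the unit circle. *)
Definition fejer D (u : C) : R := N (\sum_(a < D) u ^+ a) ^+ 2.

Lemma fejer_ge0 D u : 0 <= fejer D u. Proof. exact: sqr_ge0. Qed.

Lemma fejerE D u : N u = 1 ->
  (fejer D u)%:C%C = \sum_(x : 'I_D * 'I_D) u ^+ x.1 * u^-1 ^+ x.2.
Proof.
move=> u1; rewrite -(pair_bigA _ (fun a b : 'I_D => u ^+ a * u^-1 ^+ b)) /=.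
rewrite -big_distrlr /= normc1_conj //.
transitivity ((\sum_(a < D) u ^+ a) * (\sum_(a < D) u ^+ a)^*%C).
  by rewrite -sqr_normc /fejer rmorphXn.
by congr (_ * _); rewrite rmorph_sum; apply: eq_bigr => a _; rewrite rmorphXn.
Qed.

Lemma fejer_le D u d : N u = 1 -> 0 < d -> d <= N (u - 1) -> fejer D u <= (2 / d) ^+ 2.
Proof.
move=> u1 d0 du; rewrite ler_sqr ?nnegrE ?normc_ge0 //; last by rewrite divr_ge0 // ltW.
rewrite ler_pdivlMr // mulrC; apply: le_trans _ (normc_geometric D u1).
by rewrite ler_wpM2r ?normc_ge0.
Qed.

Let u i k := b i ^+ k / t i.
Let u1 i k : N (u i k) = 1.
Proof. by rewrite normcM normcV normcX b1 t1 expr1n invr1 mulr1. Qed.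

(** By independence the mean of the product is the product of the constant terms. The predicate J
    makes it possible to omit one factor. *)
Lemma mean_prod_fejer D (J : pred I) : exists K : R, forall n,
  `|\sum_(k < n) \prod_(i | J i) fejer D.+1 (u i k) - n%:R * D.+1%:R ^+ #|J| | <= K.
Proof.
(* Outside J the only nonzero coefficient sits at the exponents (0, 0), so that the factor is the
   constant 1. *)
pose c i (x : 'I_D.+1 * 'I_D.+1) : C :=
  if J i then (t i)^-1 ^+ x.1 * t i ^+ x.2 else (x == (ord0, ord0))%:R.
have [K hK] := mean_prod_laurent c (fun x => val x.1) (fun x => val x.2).
exists K => n; rewrite -normc_real; apply: le_trans _ (hK n).
rewrite le_eqVlt; apply/orP; left; apply/eqP; congr N.
rewrite rmorphB rmorph_sum; congr (_ - _).
  apply: eq_bigr => k _; rewrite rmorph_prod big_mkcond; apply: eq_bigr => i _.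
  rewrite /c; case: ifP => Ji; last first.
    rewrite (bigD1 (ord0, ord0)) //= ?eqxx !expr0 !mulr1 big1 ?addr0 // => x /negPf ->.
    by rewrite mul0r.
  rewrite [LHS](fejerE D.+1 (u1 i k)); apply: eq_bigr => x _.
  by rewrite /u exprMn invfM invrK exprMn mulrACA [RHS]mulrC.
rewrite rmorphM rmorphXn !rmorph_nat; congr (_ * _).
rewrite -prodr_const big_mkcond; apply: eq_bigr => i _; rewrite /c.
have diag (h : 'I_D.+1 * 'I_D.+1 -> C) :
    \sum_(x | val x.1 == val x.2) h x = \sum_a h (a, a).
  transitivity (\sum_(x | val x.1 == val x.2) h (x.1, x.2)); first by apply: eq_bigr => -[].
  rewrite -(pair_big_dep xpredT (fun a b => val a == val b) (fun a b => h (a, b))) /=.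
  by apply: eq_bigr => a _; rewrite (big_pred1 a).
rewrite diag unfold_in; case: (J i).
  transitivity (\sum_(a < D.+1) (1 : C)); first by rewrite sumr_const card_ord.
  by apply: eq_bigr => a _; rewrite /= -exprMn mulVf ?expr1n // -normc_gt0 t1.
rewrite (bigD1 ord0) //= big1 ?addr0 // => a /negPf a0.
by rewrite xpair_eqE a0.
Qed.

(** If each k had some j with [u j k] at distance at least e from 1, the j-th kernel would be at
    most B there, whatever D is. The full product, of mean D.+1 ^ |I|, would then be dominated by
    |I| products with one factor replaced by B, of total mean |I| * B * D.+1 ^ (|I| - 1): absurd for
    large D. *)
Lemma kronecker e : 0 < e -> exists s, forall i, N (b i ^+ s - t i) < e.
Proof.
move=> e0; apply: contrapT => nex.
have far k : exists i, e <= N (u i k - 1).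
  apply: contrapT => nfar; apply: nex; exists k => i; rewrite ltNge; apply/negP => h.
  apply: nfar; exists i; apply: le_trans h _.
  rewrite -[X in _ <= X]mulr1 -(t1 i) -normcM mulrBl mul1r /u divfK //.
  by rewrite -normc_gt0 t1.
pose B := (2 / e) ^+ 2.
have B0 : 0 <= B by exact: sqr_ge0.
(* As D.+1 is at least |I| * B + 1, the two means differ by at least D.+1 ^ (|I| - 1) >= 1, and n
   times this outgrows the bounded errors. *)
pose D := (Num.truncn (#|I|%:R * B) + 1)%N.
have DB : #|I|%:R * B + 1 <= D.+1%:R.
  rewrite /D -addn1 natrD lerD2r natrD; apply/ltW.
  by have := truncnS_gt (#|I|%:R * B); rewrite -addn1 natrD.
have [K hK] := mean_prod_fejer D xpredT.
have /fin_all_exists[K' hK'] := fun j => mean_prod_fejer D (predC1 j).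
have ub k : \prod_i fejer D.+1 (u i k) <=
    \sum_j B * \prod_(i | predC1 j i) fejer D.+1 (u i k).
  have [j hj] := far k; rewrite (bigD1 j) //= [X in _ <= X](bigD1 j) //=.
  apply: ler_wpDr.
    apply: sumr_ge0 => i _; rewrite mulr_ge0 ?prodr_ge0 // => *; exact: fejer_ge0.
  by rewrite ler_wpM2r ?fejer_le // prodr_ge0 // => *; exact: fejer_ge0.
have main n : n%:R * D.+1%:R ^+ #|I|.-1 <= K + B * \sum_j K' j.
  have h1 := hK n; have h2 j := hK' j n.
  have Ipos : (0 < #|I|)%N by have [i _] := far 0%N; apply/card_gt0P; exists i.
  have h3 : n%:R * D.+1%:R ^+ #|I| - K <=
      \sum_j B * (n%:R * D.+1%:R ^+ #|I|.-1 + K' j).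
    apply: le_trans (_ : \sum_(k < n) \prod_i fejer D.+1 (u i k) <= _).
      by move: h1; rewrite ler_norml => /andP[]; lra.
    apply: le_trans (ler_sum _ (fun k _ => ub (val k))) _.
    rewrite exchange_big /=; apply: ler_sum => j _; rewrite -mulr_sumr.
    rewrite ler_wpM2l //; move: (h2 j); rewrite cardC1 ler_norml => /andP[_]; lra.
  have h4 : \sum_j B * (n%:R * D.+1%:R ^+ #|I|.-1 + K' j) =
      #|I|%:R * B * (n%:R * D.+1%:R ^+ #|I|.-1) + B * \sum_j K' j.
    rewrite -mulr_sumr big_split /= sumr_const mulrDr -mulr_natl; ring.
  move: h3; rewrite h4 -{1}(prednK Ipos) exprS => h3.
  have p0 : 0 <= n%:R * D.+1%:R ^+ #|I|.-1 :> R by rewrite mulr_ge0 ?exprn_ge0.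
  have := ler_wpM2r p0 DB; rewrite mulrDl mul1r; lra.
pose L := K + B * \sum_j K' j.
have := main (Num.truncn L).+1; apply/negP; rewrite -ltNge.
apply: lt_le_trans (truncnS_gt L) _; rewrite ler_peMr //.
by rewrite exprn_ege1 // ler1n.
Qed.

End Targets.

Lemma finite_lower_bound (T : finType) (f : T -> R) (P : pred T) :
  (forall x, P x -> 0 < f x) -> exists2 k, 0 < k & forall x, P x -> k <= f x.
Proof.
move=> fP; exists (\big[Num.min/1]_(x | P x) f x).
  by elim/big_ind: _ => // x y x0 y0; rewrite lt_min x0.
by move=> x Px; apply: bigmin_le_cond.
Qed.

(* For distinct z1, z2, z3 the Vandermonde-type system with rows (z, z^-1, 1) is
   invertible, so that p is small as soon as three values are. *)
Lemma three_points (p p' h z1 z2 z3 : C) (e : R) :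
  N z1 = 1 -> N z2 = 1 -> N z3 = 1 ->
  N (p * z1 + p' * z1^-1 + h) <= e ->
  N (p * z2 + p' * z2^-1 + h) <= e ->
  N (p * z3 + p' * z3^-1 + h) <= e ->
  N p * (N (z1 - z2) * N (z1 - z3) * N (z3 - z2)) <= 8 * e.
Proof.
move=> n1 n2 n3 h1 h2 h3.
have nz z : N z = 1 -> z != 0 by move=> nz; rewrite -normc_gt0 nz.
have z10 := nz _ n1; have z20 := nz _ n2; have z30 := nz _ n3.
set x1 := p * z1 + _ + _ in h1; set x2 := p * z2 + _ + _ in h2.
set x3 := p * z3 + _ + _ in h3.
have E : p * ((z1 - z2) * (z1 - z3) * (z3 - z2)) =
   ((z1^-1 - z3^-1) * (x1 - x2) - (z1^-1 - z2^-1) * (x1 - x3)) * (z1 * z2 * z3).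
  by rewrite /x1 /x2 /x3; field; rewrite z10 z20 z30.
rewrite -!normcM E !normcM n1 n2 n3 !mulr1.
have two (x y : C) d : N x <= d -> N y <= d -> N (x - y) <= 2 * d.
  by move=> hx hy; apply: le_trans (le_normc_add _ _) _; rewrite normc_opp; lra.
have inv1 z : N z = 1 -> N z^-1 <= 1 by move=> nz1; rewrite normcV nz1 invr1.
have e0 : 0 <= e by apply: le_trans (normc_ge0 _) h1.
apply: le_trans (le_normc_add _ _) _; rewrite normc_opp !normcM.
have bound (x y : C) : N x <= 2 * 1 -> N y <= 2 * e -> N x * N y <= 4 * e.
  move=> hx hy; apply: le_trans (ler_pM _ _ hx hy) _; rewrite ?normc_ge0 //; lra.
have := bound _ _ (two _ _ _ (inv1 _ n1) (inv1 _ n3)) (two _ _ _ h1 h2).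
have := bound _ _ (two _ _ _ (inv1 _ n1) (inv1 _ n2)) (two _ _ _ h1 h3).
lra.
Qed.

(** * Signs and small values of almost periodic sequences *)

Section Oscillation.
Variables (A B : I -> C) (i0 : I) (g : nat -> R).
Hypothesis A0 : A i0 != 0.
Hypothesis g_asymp : forall e, 0 < e -> exists K, forall k, (K <= k)%N ->
  N ((g k)%:C%C - \sum_i (A i * b i ^+ k + B i * (b i)^-1 ^+ k)) < e.

(** A Kronecker shift multiplies the weights by t i and its inverse. The error is uniform in k
    because the powers of b i have modulus 1. *)
Lemma shift_approx (t : I -> C) (e : R) : (forall i, N (t i) = 1) -> 0 < e ->
  exists s K, forall k, (K <= k)%N ->
  N ((g (k + s))%:C%C -
     \sum_i (A i * b i ^+ k * t i + B i * (b i)^-1 ^+ k * (t i)^-1)) < e.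
Proof.
move=> t1 e0; pose M := \sum_i (N (A i) + N (B i)).
have M0 : 0 <= M by apply: sumr_ge0 => i _; rewrite addr_ge0 ?normc_ge0.
have d0 : 0 < e / 2 / (M + 1) by rewrite !divr_gt0 // ltr_wpDl.
have [s hs] := kronecker t1 d0.
have [K hK] := g_asymp (divr_gt0 e0 (ltr0Sn R 1)).
exists s, K => k Kk.
have := hK (k + s)%N (leq_trans Kk (leq_addr _ _)).
set G := \sum_i _; set H := \sum_i _.
have GH : N (G - H) <= e / 2.
  rewrite /G /H -sumrB; apply: le_trans (normc_sum _ _ _) _.
  apply: (@le_trans _ _ (\sum_i (N (A i) + N (B i)) * (e / 2 / (M + 1)))).
    apply: ler_sum => i _.
    have ti0 : t i != 0 by rewrite -normc_gt0 t1.
    have -> : A i * b i ^+ (k + s) + B i * (b i)^-1 ^+ (k + s) -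
        (A i * b i ^+ k * t i + B i * (b i)^-1 ^+ k * (t i)^-1) =
        A i * b i ^+ k * (b i ^+ s - t i) +
        B i * (b i)^-1 ^+ k * ((t i - b i ^+ s) * ((b i)^-1 ^+ s * (t i)^-1)).
      have -> : (t i - b i ^+ s) * ((b i)^-1 ^+ s * (t i)^-1) = (b i)^-1 ^+ s - (t i)^-1.
        by rewrite exprVn; field; rewrite ti0 expf_neq0.
      rewrite !exprD; ring.
    apply: le_trans (le_normc_add _ _) _.
    rewrite !normcM (normcBC (t i)) !normcX !normcV !b1 t1 invr1 !expr1n !mulr1 -mulrDl.
    by rewrite ler_wpM2l ?addr_ge0 ?normc_ge0 // ltW.
  rewrite -mulr_suml mulrCA ler_piMr ?divr_ge0 ?ltW //.
  by rewrite ltr_pdivrMr ?ltr_wpDl // mul1r ltrDl.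
move=> h; rewrite -[_ - H](subrKA G); apply: le_lt_trans (le_normc_add _ _) _; lra.
Qed.

Lemma near_antiperiod (e : R) : 0 < e ->
  exists s K, forall k, (K <= k)%N -> `|g (k + s) + g k| < e.
Proof.
move=> e0; have e2 : 0 < e / 2 by rewrite divr_gt0.
have [s [K hK]] := @shift_approx (fun=> -1) (e / 2)
  (fun=> etrans (normc_opp _) (normc1 R)) e2.
have [K' hK'] := g_asymp e2.
exists s, (maxn K K') => k; rewrite geq_max => /andP[Kk K'k].
have := hK k Kk; have := hK' k K'k.
rewrite [X in N (_ - X) < _ -> _ -> _](_ : _ = - \sum_i (A i * b i ^+ k * -1 +
    B i * (b i)^-1 ^+ k * (-1)^-1)); last first.
  by rewrite -sumrN; apply: eq_bigr => i _; rewrite invrN1 !mulrN1 opprD !opprK.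
set H := \sum_i _ => h1 h2.
have E : (g (k + s) + g k)%:C%C = ((g (k + s))%:C%C - H) + ((g k)%:C%C - - H).
  by rewrite opprK addrACA addNr addr0 rmorphD.
rewrite -normc_real E.
by apply: le_lt_trans (le_normc_add _ _) _; lra.
Qed.

Lemma few_small_values n : exists2 e : R, 0 < e &
  exists (s : 'I_n -> nat) (K : nat), forall k, (K <= k)%N ->
  (#|[pred l | (`|g (k + s l)| <= e)%R]| <= 2)%N.
Proof.
(* The rotations are powers of b i0 itself, distinct because b i0 is not a root of unity. *)
pose z (l : 'I_n) := b i0 ^+ l.
have z1 l : N (z l) = 1 by rewrite normcX b1 expr1n.
have zinj : injective z.
  move=> l l' E; apply/val_inj => /=.
  have prodE m : \prod_i b i ^+ (if i == i0 then m else 0%N) = b i0 ^+ m.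
    by rewrite (bigD1 i0) //= eqxx big1 ?mulr1 // => i /negPf ->.
  have := @b_indep (fun i => if i == i0 then val l else 0%N)
    (fun i => if i == i0 then val l' else 0%N).
  by rewrite !prodE => /(_ E)/(_ i0); rewrite eqxx.
have [|kp kp0 hkp] := @finite_lower_bound ('I_n * 'I_n)%type
    (fun x => N (z x.1 - z x.2)) (fun x => x.1 != x.2).
  by move=> [l l'] /= ll'; rewrite normc_gt0 subr_eq0 (inj_eq zinj).
(* Three shifted values of size at most e give, after the approximation error e, three values at
   most 2 * e; [three_points] then bounds |A i0| * kp ^ 3 by 16 * e, which is half of it. *)
pose e := N (A i0) * (kp * kp * kp) / 32.
have A0' : 0 < N (A i0) by rewrite normc_gt0.
have e0 : 0 < e by rewrite divr_gt0 ?mulr_gt0.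
pose t l i : C := if i == i0 then z l else 1.
have t1 l i : N (t l i) = 1 by rewrite /t; case: ifP => // _; exact: normc1.
have /fin_all_exists[s /fin_all_exists[K hK]] := fun l => shift_approx (t1 l) e0.
exists e => //; exists s, (\max_l K l)%N => k Kk.
rewrite leqNgt; apply/negP => /card_gt2P[l1 [l2 [l3 [[h1 h2 h3] [d12 d23 d31]]]]].
pose p := A i0 * b i0 ^+ k; pose p' := B i0 * (b i0)^-1 ^+ k.
(* The rotations leave the other frequencies alone, so [H] is the same for all l and plays the
   constant term in [three_points]. *)
pose H := \sum_(i | i != i0) (A i * b i ^+ k + B i * (b i)^-1 ^+ k).
have small l : l \in [pred l | (`|g (k + s l)| <= e)%R] ->
    N (p * z l + p' * (z l)^-1 + H) <= 2 * e.
  rewrite inE => gl; have Kl : (K l <= k)%N := leq_trans (leq_bigmax l) Kk.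
  have := hK l k Kl; rewrite (bigD1 i0) //= {1 2}/t eqxx.
  rewrite [\sum_(i | i != i0) _](_ : _ = H) => [h|]; last first.
    by apply: eq_bigr => i /negPf i_i0; rewrite /t i_i0 invr1 !mulr1.
  rewrite -[X in N X](subrK (g (k + s l))%:C%C).
  apply: le_trans (le_normc_add _ _) _; rewrite normcBC normc_real.
  by rewrite -/p -/p' in h; lra.
have := three_points (z1 l1) (z1 l2) (z1 l3) (small _ h1) (small _ h2) (small _ h3).
have Np : N p = N (A i0) by rewrite normcM normcX b1 expr1n mulr1.
rewrite Np; apply/negP; rewrite -ltNge.
have k1 := hkp (l1, l2) d12.
have k3 : kp <= N (z l3 - z l2) by rewrite normcBC; exact: (hkp (l2, l3) d23).
have k2 : kp <= N (z l1 - z l3) by rewrite normcBC; exact: (hkp (l3, l1) d31).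
have k0 := ltW kp0.
have lb : N (A i0) * (kp * kp * kp) <=
    N (A i0) * (N (z l1 - z l2) * N (z l1 - z l3) * N (z l3 - z l2)).
  by rewrite ler_wpM2l ?normc_ge0 // !ler_pM // mulr_ge0.
apply: lt_le_trans lb; rewrite /e.
have : 0 < N (A i0) * (kp * kp * kp) by rewrite !mulr_gt0.
lra.
Qed.

Local Notation cnt S n := (count S (iota 1 n)).

Lemma small_values_density (e : R) : 0 < e ->
  exists2 d, 0 < d & exists c : R, forall n,
    (cnt (fun k => `|g k| <= d)%R n)%:R <= c + e * n%:R.
Proof.
move=> e0; pose m := (Num.truncn (2 / e)).+1.
have m0 : 0 < m%:R :> R by rewrite ltr0n.
have me : 2 / m%:R <= e.
  by rewrite ler_pdivrMr // mulrC -ler_pdivrMr // ltW // truncnS_gt.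
have [d d0 [s [K hK]]] := few_small_values m.
exists d => //; exists ((\sum_l s l + K * m)%N%:R / m%:R) => n.
have := count_iota_average (S := fun k => (`|g k| <= d)%R) n hK.
rewrite -(ler_nat R) natrM natrD natrM => h.
rewrite -(ler_pM2l m0); apply: le_trans h _.
rewrite mulrDr mulrCA divff ?mulr1 ?gt_eqF // lerD2l mulrA ler_wpM2r //.
by rewrite mulrC -ler_pdivrMr.
Qed.

Lemma sign_exchange (d : R) : 0 < d -> exists c : nat, forall n,
  (cnt (fun k => d < g k)%R n <= c + cnt (fun k => g k < 0)%R n)%N /\
  (cnt (fun k => g k < - d)%R n <= c + cnt (fun k => 0 < g k)%R n)%N.
Proof.
move=> d0; have [s [K hK]] := near_antiperiod d0.
exists (K + s)%N => n; split; rewrite -addnA.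
  apply: leq_trans (count_iota_eventually (K := K) (S' := fun k => (g (k + s) < 0)%R) n _) _.
    by move=> k /hK; rewrite ltr_norml => /andP[]; lra.
  by rewrite leq_add2l (count_iota_shift_le (fun k => (g k < 0)%R)).
apply: leq_trans (count_iota_eventually (K := K) (S' := fun k => (0 < g (k + s))%R) n _) _.
  by move=> k /hK; rewrite ltr_norml => /andP[]; lra.
by rewrite leq_add2l (count_iota_shift_le (fun k => (0 < g k)%R)).
Qed.

Theorem sign_densities :
  [/\ has_density (fun k => 0 < g k) (1 / 2 : R),
      has_density (fun k => g k < 0) (1 / 2 : R) &
      has_density (fun k => g k == 0) (0 : R)].
Proof.
have total n : (cnt (fun k => 0 < g k)%R n)%:R + (cnt (fun k => g k < 0)%R n)%:R
    + (cnt (fun k => g k == 0)%R n)%:R = n%:R :> R.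
  rewrite -!natrD -[in RHS](size_iota 1 n); congr _%:R.
  by elim: (iota 1 n) => //= k r <-; case: ltrgtP; lia.
have split_small d n : 0 < d ->
    [/\ (cnt (fun k => 0 < g k)%R n <= cnt (fun k => d < g k)%R n +
          cnt (fun k => `|g k| <= d)%R n)%N,
        (cnt (fun k => g k < 0)%R n <= cnt (fun k => g k < - d)%R n +
          cnt (fun k => `|g k| <= d)%R n)%N &
        (cnt (fun k => g k == 0)%R n <= cnt (fun k => `|g k| <= d)%R n)%N].
  move=> d0; split; last by apply: sub_count => k /= /eqP ->; rewrite normr0 ltW.
    rewrite -count_predUI; apply: leq_trans (leq_addr _ _); apply: sub_count => k /= gk.
    by rewrite gtr0_norm // ltNge orNb.
  rewrite -count_predUI; apply: leq_trans (leq_addr _ _); apply: sub_count => k /= gk.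
  by rewrite ltr0_norm // lerNl ltNge orNb.
(* With [small] the count of |g| <= d, twice the positive count lies between n - c' - 2 * small and
   n + c' + small, and likewise for the negative one: zeros are among the small values. *)
have key (e : R) : 0 < e -> exists c : R, forall n,
    [/\ `|(cnt (fun k => 0 < g k)%R n)%:R - 1 / 2 * n%:R| <= c + e * n%:R,
        `|(cnt (fun k => g k < 0)%R n)%:R - 1 / 2 * n%:R| <= c + e * n%:R &
        `|(cnt (fun k => g k == 0)%R n)%:R - 0 * n%:R| <= c + e * n%:R].
  move=> e0; have [d d0 [c hc]] := small_values_density e0.
  have [c' hc'] := sign_exchange d0.
  exists (c + c'%:R) => n; have := hc n; have [h1 h2] := hc' n; have := total n.
  have [h3 h4 h5] := split_small d n d0.
  move: h1 h2 h3 h4 h5; rewrite -!(ler_nat R) !natrD => h1 h2 h3 h4 h5 h6 h7.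
  have c0 : 0 <= c'%:R :> R by [].
  have z0 : 0 <= (cnt (fun k => g k == 0)%R n)%:R :> R by [].
  by split; rewrite ler_norml; apply/andP; split; lra.
split; apply: has_density_linear => e e0; have [c hc] := key e e0; exists c => n;
  by have [] := hc n.
Qed.

End Oscillation.
End Independent.
End Kronecker.

(** * Partial fractions *)

Section PowerSeries.
Variable K : fieldType.
Implicit Types (p q : {poly K}) (x y : nat -> K) (c : K).

(** Power series are plain sequences, and this is the coefficient of u^n in p times the series of x.
    Truncating x to a polynomial lets [convM] inherit associativity from [{poly K}]. *)
Definition conv p x n : K := \sum_(i < n.+1) p`_i * x (n - i)%N.

Lemma convE p x n N : (n < N)%N -> conv p x n = (p * \poly_(i < N) x i)`_n.
Proof.
move=> nN; rewrite coefM; apply: eq_bigr => i _.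
by rewrite coef_poly (leq_ltn_trans (leq_subr _ _) nN).
Qed.

Lemma convM p q x n : conv (p * q) x n = conv p (conv q x) n.
Proof.
rewrite (convE _ _ (ltnSn n)) -mulrA coefM; apply: eq_bigr => i _.
by rewrite -convE // ltnS leq_subr.
Qed.

Lemma conv_1subZX c x : (forall n, conv (1 - c *: 'X) x n.+1 = x n.+1 - c * x n) /\
  conv (1 - c *: 'X) x 0 = x 0%N.
Proof.
split=> [n|]; last first.
  by rewrite /conv big_ord1 coefB coef1 coefZ coefX mulr0 subr0 mul1r.
rewrite /conv 2!big_ord_recl big1 => [|i _].
  by rewrite !coefB !coef1 !coefZ !coefX /= /bump /= !subn0 subn1; ring.
by rewrite coefB coef1 coefZ coefX /= mulr0 subr0 mul0r.
Qed.

(** Division by 1 - c u is convolution with a geometric series; for c = 1 it is partial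
    summation. *)
Lemma geometric_unconv c x n :
  x n = \sum_(k < n.+1) c ^+ (n - k) * conv (1 - c *: 'X) x k.
Proof.
have [E E0] := conv_1subZX c x.
elim: n => [|n IH]; first by rewrite big_ord1 E0 subn0 mul1r.
rewrite big_ord_recr /= subnn E mul1r.
have -> : \sum_(k < n.+1) c ^+ (n.+1 - k) * conv (1 - c *: 'X) x k = c * x n.
  rewrite IH mulr_sumr; apply: eq_bigr => k _.
  by rewrite mulrA -exprS subSn // -ltnS.
by ring.
Qed.

(** Dividing a combination of the 1 / (1 - a u) by one new factor 1 - c u: this gives the weights
    after one more inverse root. *)
Lemma sum_geometric_mix (l : seq K) (A : K -> K) c n : c \notin l ->
  \sum_(k < n.+1) c ^+ (n - k) * \sum_(a <- l) A a * a ^+ k =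
  \sum_(a <- l) A a * a / (a - c) * a ^+ n - (\sum_(a <- l) A a * c / (a - c)) * c ^+ n.
Proof.
move=> cl; under eq_bigr do rewrite mulr_sumr.
rewrite exchange_big /= mulr_suml -sumrB; apply: eq_big_seq => a al.
have ac : a - c != 0 by rewrite subr_eq0; apply: contraNneq cl => <-.
have -> : \sum_(k < n.+1) c ^+ (n - k) * (A a * a ^+ k) =
    A a * (a ^+ n.+1 - c ^+ n.+1) / (a - c).
  have -> : a ^+ n.+1 - c ^+ n.+1 = (a - c) * \sum_(k < n.+1) c ^+ (n - k) * a ^+ k.
    by rewrite -opprB subrXX -mulNr opprB.
  rewrite [A a * _]mulrCA [RHS]mulrC mulKf //.
  by rewrite mulr_sumr; apply: eq_bigr => k _; rewrite mulrCA.
by rewrite !exprS; field.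
Qed.

(** The induction starts from a0 alone and adds the other inverse roots one by one. Each new c
    multiplies the weight at a0 by a0 / (a0 - c), so this weight stays nonzero. *)
Lemma partial_fractions (l : seq K) a0 x : uniq l -> 0 \notin l -> a0 \in l ->
  (forall n, conv (\prod_(a <- l) (1 - a *: 'X)) x n = (n == 0%N)%:R) ->
  exists2 A : K -> K, A a0 != 0 & forall n, x n = \sum_(a <- l) A a * a ^+ n.
Proof.
move=> ul l0 al.
have pl := perm_to_rem al; move: ul l0; rewrite (perm_uniq pl) (perm_mem pl).
rewrite (perm_big _ pl) /=.
suff H s : uniq (a0 :: s) -> 0 \notin a0 :: s ->
    (forall n, conv (\prod_(a <- a0 :: s) (1 - a *: 'X)) x n = (n == 0%N)%:R) ->
    exists2 A : K -> K, A a0 != 0 & forall n, x n = \sum_(a <- a0 :: s) A a * a ^+ n.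
  move=> u0 n0 /(H _ u0 n0)[A A0 AE]; exists A => // n.
  by rewrite AE (perm_big _ pl).
elim: s x {pl} => [|c s IH] x.
  move=> _ _; rewrite big_seq1 => xE; exists (fun=> 1); first exact: oner_neq0.
  move=> n; rewrite big_seq1 mul1r (geometric_unconv a0 x) big_ord_recl big1 => [|i _].
    by rewrite xE subn0 mulr1 addr0.
  by rewrite xE mulr0.
move=> u0 n0 xE.
have pac : perm_eq (a0 :: c :: s) (c :: a0 :: s).
  exact/permPl/(perm_catCA [:: a0] [:: c] s).
move: u0 n0; rewrite (perm_uniq pac) (perm_mem pac) /= => /andP[cs us].
rewrite inE negb_or => /andP[_ n0].
have [|A A0 AE] := IH (conv (1 - c *: 'X) x) us n0.
  by move=> n; rewrite -convM mulrC -xE (perm_big _ pac) [in RHS]big_cons.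
pose A' a := if a == c then - \sum_(a <- a0 :: s) A a * c / (a - c) else A a * a / (a - c).
have a0c : a0 != c by apply: contraNneq cs => <-; rewrite mem_head.
exists A'.
  rewrite /A' (negPf a0c) !mulf_neq0 ?invr_neq0 ?subr_eq0 //.
  by apply: contraNneq n0 => <-; rewrite mem_head.
move=> n; rewrite (perm_big _ pac) /= big_cons.
have -> : x n = \sum_(k < n.+1) c ^+ (n - k) * \sum_(a <- a0 :: s) A a * a ^+ k.
  by rewrite (geometric_unconv c x); apply: eq_bigr => k _; rewrite AE.
rewrite sum_geometric_mix // addrC /A' eqxx mulNr; congr (_ + _).
apply: eq_big_seq => a als; rewrite ifF //.
by apply: contraNF cs => /eqP <-.
Qed.

End PowerSeries.

(** * Exponential sums with a smaller exponential error *)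

Section Dominant.
Variable R : realType.
Local Notation C := R[i].
Local Notation N := (@ComplexField.Normc.normc R).
Import ComplexField.Normc.
Variables (J : finType) (h : J -> C) (j0 : J) (rho : R).
Hypothesis rho1 : 1 < rho.
Hypothesis h1 : forall j, h j != 1.
Hypothesis hj0 : h j0 != 0.

(** As rho > 1, the error absorbs the additive constants that summation and dropping an initial term
    create; it is negligible once rho lies below the common modulus of the h j. *)
Definition exp_main_term (x : nat -> C) : Prop :=
  exists2 A : J -> C, A j0 != 0 &
  exists c : R, forall n, N (x n - \sum_j A j * h j ^+ n) <= c * rho ^+ n.

(** Summation multiplies the weight at h j by h j / (h j - 1), which is nonzero at j0, and leaves a
    constant [D] for the error. *)
Lemma exp_main_term_sum x : exp_main_term x ->
  exp_main_term (fun n => \sum_(k < n.+1) x k).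
Proof.
move=> [A A0 [c hc]]; have rho0 : 0 < rho - 1 by rewrite subr_gt0.
have hn1 j : h j - 1 != 0 by rewrite subr_eq0.
exists (fun j => A j * h j / (h j - 1)); first by rewrite !mulf_neq0 ?invr_neq0.
pose D := \sum_j A j / (h j - 1).
exists (N D + c * (rho / (rho - 1))) => n.
have E : \sum_(k < n.+1) \sum_j A j * h j ^+ k =
    \sum_j A j * h j / (h j - 1) * h j ^+ n - D.
  rewrite exchange_big -sumrB; apply: eq_bigr => j _.
  rewrite -mulr_sumr; have -> : \sum_(k < n.+1) h j ^+ k = (h j ^+ n.+1 - 1) / (h j - 1).
    by rewrite subrX1 mulrC mulKf.
  by rewrite exprS; field.
have -> : \sum_(k < n.+1) x k - \sum_j A j * h j / (h j - 1) * h j ^+ n =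
    \sum_(k < n.+1) (x k - \sum_j A j * h j ^+ k) - D.
  by rewrite sumrB E; ring.
have rn : 1 <= rho ^+ n by rewrite exprn_ege1 // ltW.
have c0 : 0 <= c.
  by apply: le_trans (normc_ge0 (x 0%N - \sum_j A j * h j ^+ 0)) _; rewrite -[c]mulr1 hc.
apply: le_trans (le_normc_add _ _) _; rewrite normc_opp addrC mulrDl.
apply: lerD; first by rewrite ler_peMr ?normc_ge0.
apply: le_trans (normc_sum _ _ _) _.
apply: (@le_trans _ _ (\sum_(k < n.+1) c * rho ^+ k)); first exact: ler_sum.
rewrite -mulr_sumr -mulrA ler_wpM2l //.
have -> : \sum_(k < n.+1) rho ^+ k = (rho ^+ n.+1 - 1) / (rho - 1).
  by rewrite subrX1 mulrC mulKf ?gt_eqF.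
rewrite exprS [rho / _ * _]mulrAC; apply: ler_wpM2r; first by rewrite invr_ge0 ltW.
by rewrite lerBlDr lerDl.
Qed.

Lemma exp_main_term_subC x (a : C) : exp_main_term x -> exp_main_term (fun n => x n - a).
Proof.
move=> [A A0 [c hc]]; exists A => //; exists (c + N a) => n.
rewrite addrAC mulrDl; apply: le_trans (le_normc_add _ _) _; rewrite normc_opp.
by apply: lerD => //; rewrite ler_peMr ?normc_ge0 // exprn_ege1 // ltW.
Qed.

End Dominant.

(** * From linear independence of angles to multiplicative independence *)

Section Angles.
Variable R : realType.
Local Notation C := R[i].
Local Notation N := (@ComplexField.Normc.normc R).
Import ComplexField.Normc.

Lemma expiD (x y : R) : expi (x + y) = expi x * expi y.
Proof.
rewrite /expi cosD sinD.
by apply/eqP; rewrite eq_complex /= eqxx /=; apply/eqP; ring.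
Qed.

Lemma expi0 : expi (0 : R) = 1.
Proof. by rewrite /expi cos0 sin0. Qed.

Lemma normc_expi (x : R) : N (expi x) = 1.
Proof. by rewrite /expi /normc cos2Dsin2 sqrtr1. Qed.

Lemma expiN (x : R) : expi (- x) = (expi x)^-1.
Proof.
have e0 : expi x != 0 by rewrite -normc_gt0 normc_expi.
by apply: (mulfI e0); rewrite divff // -expiD subrr expi0.
Qed.

Lemma expi_prod (I : finType) (f : I -> R) (a : I -> nat) :
  \prod_i expi (f i) ^+ a i = expi (\sum_i (a i)%:R * f i).
Proof.
have expiX x n : expi x ^+ n = expi (n%:R * x :> R).
  elim: n => [|n IH]; first by rewrite mul0r expi0.
  by rewrite exprS IH -expiD -natr1; congr expi; ring.
rewrite (big_morph _ expiD expi0); apply: eq_bigr => i _; exact: expiX.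
Qed.

Lemma cos_eq1 (x : R) : cos x = 1 -> exists z : int, x = z%:~R * (pi *+ 2).
Proof.
move=> cx; have pi0 : 0 < pi *+ 2 :> R by rewrite pmulrn_lgt0 // pi_gt0.
suff [n nE] : exists n : nat, `|x| = n%:R * (pi *+ 2).
  have [x0|x0] := leP 0 x.
    by exists n%:Z; rewrite -nE ger0_norm.
  by exists (- n%:Z); rewrite mulrNz mulNr -nE ltr0_norm // opprK.
pose n := Num.truncn (`|x| / (pi *+ 2)); exists n.
have /andP[nle nlt] : n%:R <= `|x| / (pi *+ 2) < n.+1%:R.
  by apply: truncn_itv; rewrite divr_ge0 // ltW.
pose r : R := `|x| - n%:R * (pi *+ 2).
have r0 : 0 <= r by rewrite subr_ge0 -ler_pdivlMr.
have r2 : r < pi *+ 2.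
  by move: nlt; rewrite ltr_pdivrMr // -natr1 mulrDl mul1r /r; lra.
have cr : cos r = 1.
  rewrite -(periodicn (@cosD2pi R) n r) -[_ *+ n]mulr_natl /r subrK.
  by rewrite cos_norm.
have cos1 (y : R) : 0 <= y <= pi -> cos y = 1 -> y = 0.
  move=> /andP[y0 yp] cy; apply: cos_inj; rewrite ?in_itv /= ?y0 ?yp ?lexx ?pi_ge0 //.
  by rewrite cos0.
apply/eqP; rewrite -subr_eq0 -/r; have [rp|rp] := leP r pi.
  by rewrite (cos1 r) // r0.
have : pi *+ 2 - r = 0.
  apply: cos1; first by rewrite subr_ge0 ltW //= lerBlDr mulr2n lerD2l ltW.
  by rewrite -cos_norm distrC cos_norm -(cosD2pi) subrK.
move/eqP; rewrite subr_eq0 => /eqP E; move: r2; rewrite E ltxx //.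
Qed.

(** Equal products mean that the sum of (a i - c i) theta_i is 2 pi z with z an integer. This is a
    rational relation with coefficient -2 z at pi, which is why pi belongs to the independent
    family. *)
Lemma Q_independent_expi (theta : seq R) (a c : 'I_(size theta) -> nat) :
  Q_independent (pi :: theta) ->
  \prod_(i < size theta) expi theta`_i ^+ a i =
  \prod_(i < size theta) expi theta`_i ^+ c i -> a =1 c.
Proof.
rewrite !(expi_prod (fun i : 'I_(size theta) => theta`_i)) => ind /eqP; rewrite -subr_eq0 => E i.
pose Y := \sum_(i < size theta) ((a i)%:R - (c i)%:R) * theta`_i.
have : expi Y = 1.
  have -> : Y = \sum_(i < size theta) (a i)%:R * theta`_i +
      - \sum_(i < size theta) (c i)%:R * theta`_i.
    by rewrite -sumrB; apply: eq_bigr => j _; rewrite mulrBl.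
  rewrite expiD expiN; move/eqP: E => /subr0_eq ->; rewrite divff //.
  by rewrite -normc_gt0 normc_expi.
move=> /(congr1 (@complex.Re R)) /= /cos_eq1[z zE].
pose d (k : 'I_(size (pi :: theta))) : rat :=
  if unlift ord0 k is Some k' then (a k')%:R - (c k')%:R else - (z%:~R * 2).
have := ind d; rewrite big_ord_recl {1}/d unlift_none /=.
under eq_bigr do rewrite /d liftK rmorphB /= !ratr_nat.
rewrite -/Y zE rmorphN rmorphM /= ratr_int ratr_nat.
have -> : - (z%:~R * 2) * pi + z%:~R * (pi *+ 2) = 0 :> R by ring.
move=> /(_ erefl)/(_ (lift ord0 i)); rewrite /d liftK => /eqP.
by rewrite subr_eq0 eqr_nat => /eqP.
Qed.

End Angles.

(** * The inverse roots of the L-function *)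

Section InverseRoots.
Variables (R : realType) (F : finFieldType).
Local Notation C := R[i].
Local Notation N := (@ComplexField.Normc.normc R).
Import ComplexField.Normc.
Variables (theta : seq R) (i0 : 'I_(size theta)).
Hypothesis theta_indep : Q_independent (pi :: theta).
Hypothesis F_gt2 : (2 < #|F|)%N.

Let q : R := Num.sqrt #|F|%:R.
Let beta (i : 'I_(size theta)) : C := expi theta`_i.

Definition inverse_root (j : 'I_(size theta) * bool) : C :=
  q%:C%C * (if j.2 then beta j.1 else (beta j.1)^-1).

(** Since |F| >= 3 and (3 / 2) ^ 2 < 3, the error rate 3 / 2 fits strictly between 1 and the modulus
    of the inverse roots. *)
Let q_gt : 3 / 2 < q.
Proof.
have q0 : 0 <= q := sqrtr_ge0 _.
have q2 : q ^+ 2 = #|F|%:R by rewrite sqr_sqrtr.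
have : 3 <= #|F|%:R :> R by rewrite ler_nat.
rewrite -q2 ltNge => q3; apply/negP => q32.
have : q ^+ 2 <= (3 / 2) ^+ 2 by rewrite lerXn2r ?nnegrE //; lra.
by rewrite expr_div_n; lra.
Qed.

Let q0 : 0 < q. Proof. by apply: lt_trans q_gt; lra. Qed.

Let beta_neq0 i : beta i != 0.
Proof. by rewrite -normc_gt0 normc_expi. Qed.

Lemma normc_inverse_root j : N (inverse_root j) = q.
Proof.
rewrite normcM normc_real gtr0_norm //; case: j.2; rewrite ?normcV normc_expi ?invr1 mulr1 //.
Qed.

Lemma inverse_root_neq0 j : inverse_root j != 0.
Proof. by rewrite -normc_gt0 normc_inverse_root. Qed.

Lemma inverse_root_neq1 j : inverse_root j != 1.
Proof.
apply/eqP => /(congr1 N); rewrite normc_inverse_root normc1 => q1.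
by move: q_gt; rewrite q1; lra.
Qed.

(** A coincidence would be a multiplicative relation between the [beta i]. Taking i = i' in [betaV]
    also excludes the real values sqrt |F| and - sqrt |F|. *)
Lemma inverse_root_inj : injective inverse_root.
Proof.
have prodE i k : \prod_i' beta i' ^+ (if i' == i then k else 0%N) = beta i ^+ k.
  by rewrite (bigD1 i) //= eqxx big1 ?mulr1 // => i' /negPf ->.
have beta_inj i i' : beta i = beta i' -> i = i'.
  move=> E; have := @Q_independent_expi _ theta (fun j => if j == i then 1 else 0)%N
    (fun j => if j == i' then 1 else 0)%N theta_indep.
  rewrite !prodE !expr1 => /(_ E)/(_ i); rewrite eqxx.
  by case: eqP.
have betaV i i' : beta i != (beta i')^-1.
  apply/eqP => E; have := @Q_independent_expi _ theta
    (fun j => (if j == i then 1 else 0) + (if j == i' then 1 else 0))%N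
    (fun=> 0%N) theta_indep.
  under eq_bigr do rewrite exprD.
  rewrite big_split /= !prodE !expr1 E mulVf // big1 // => /(_ erefl)/(_ i).
  by rewrite eqxx.
have qC0 : q%:C%C != 0 :> C by rewrite -normc_gt0 normc_real gtr0_norm.
move=> [i s] [i' s'] /(mulfI qC0) /=; case: s; case: s' => E.
- by rewrite (beta_inj _ _ E).
- by move: (betaV i i'); rewrite E eqxx.
- by move: (betaV i' i); rewrite E eqxx.
- by rewrite (beta_inj _ _ (invr_inj E)).
Qed.

Lemma LfactoredE M : Lfactored F M theta =
  (if odd M then 1 else 1 - 'X) * \prod_j (1 - inverse_root j *: 'X).
Proof.
rewrite /Lfactored; congr (_ * _).
rewrite (big_nth 0) big_mkord.
rewrite -(pair_bigA _ (fun i s => 1 - inverse_root (i, s) *: 'X)) /=.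
by apply: eq_bigr => i _; rewrite big_bool /= expiN.
Qed.

Local Notation main_term := (exp_main_term inverse_root (i0, true) (3 / 2)).

Lemma main_term_inverse x :
  (forall n, conv (\prod_j (1 - inverse_root j *: 'X)) x n = (n == 0%N)%:R) ->
  main_term x.
Proof.
pose l := [seq inverse_root j | j <- enum {: 'I_(size theta) * bool}].
have lE (T : Type) (idx : T) (op : Monoid.com_law idx) (f : C -> T) :
    \big[op/idx]_(a <- l) f a = \big[op/idx]_j f (inverse_root j).
  by rewrite big_map big_enum.
rewrite -(lE _ _ _ (fun a => 1 - a *: 'X)) => xE.
have [|||A A0 AE] := @partial_fractions _ l (inverse_root (i0, true)) x _ _ _ xE.
- by rewrite map_inj_uniq ?enum_uniq //; exact: inverse_root_inj.
- by apply/mapP => -[j _ /esym/eqP]; rewrite (negPf (inverse_root_neq0 j)).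
- by rewrite map_f // mem_enum.
exists (A \o inverse_root) => //; exists 0 => n.
by rewrite AE lE subrr normc0 mul0r.
Qed.

(** Dividing by q ^ n keeps signs and moves the inverse roots to the unit circle, while the error
    decays like (3 / 2 / q) ^ n. *)
Lemma main_term_densities (x : nat -> int) : main_term (fun n => (x n)%:~R) ->
  [/\ has_density (fun k => 0 < x k) (1 / 2 : R),
      has_density (fun k => x k < 0) (1 / 2 : R) &
      has_density (fun k => x k == 0) (0 : R)].
Proof.
move=> [A A0 [c hc]].
pose g n : R := (x n)%:~R / q ^+ n.
have qn n : 0 < q ^+ n by rewrite exprn_gt0.
have [||e e0|dpos dneg dzero] := @sign_densities R _ beta _ _ (fun i => A (i, true))
  (fun i => A (i, false)) i0 g A0.
- by move=> i; exact: normc_expi.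
- by move=> a a'; exact: Q_independent_expi.
- pose d := e / (`|c| + 1).
  have c1 : 0 < `|c| + 1 by rewrite ltr_wpDl.
  have d0 : 0 < d by rewrite divr_gt0.
  have r1 : `|3 / 2 / q| < 1.
    by rewrite ger0_norm ?divr_ge0 ?(ltW q0) // ltr_pdivrMr // mul1r.
  have /cvgr0Pnorm_lt/(_ d d0)[K _ hK] := cvg_expr r1.
  exists K => k Kk.
  have -> : (g k)%:C%C - \sum_i (A (i, true) * beta i ^+ k + A (i, false) * (beta i)^-1 ^+ k) =
      ((x k)%:~R - \sum_j A j * inverse_root j ^+ k) * ((q ^+ k)^-1)%:C%C.
    rewrite mulrBl; congr (_ - _); first by rewrite /g rmorphM rmorph_int.
    have sumJ (f : 'I_(size theta) * bool -> C) :
        \sum_j f j = \sum_i (f (i, true) + f (i, false)).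
      transitivity (\sum_j f (j.1, j.2)); first by apply: eq_bigr => -[].
      rewrite -(pair_bigA _ (fun i s => f (i, s))) /=.
      by apply: eq_bigr => i _; rewrite big_bool.
    rewrite sumJ mulr_suml; apply: eq_bigr => i _; rewrite /inverse_root /= !exprMn.
    have qk : (q%:C%C ^+ k) * ((q ^+ k)^-1)%:C%C = 1 :> C.
      by rewrite -rmorphXn -rmorphM divff ?rmorph1 // gt_eqF.
    by rewrite -[LHS]mulr1 -qk; ring.
  rewrite normcM normc_real ger0_norm ?invr_ge0 ?(ltW (qn k)) //.
  rewrite ltr_pdivrMr //; apply: le_lt_trans (hc k) _.
  have := hK k Kk; rewrite ger0_norm; last by rewrite exprn_ge0 // divr_ge0 // ltW.
  rewrite expr_div_n ltr_pdivrMr // => h.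
  have rk : 0 < (3 / 2 : R) ^+ k by rewrite exprn_gt0.
  apply: (@le_lt_trans _ _ ((`|c| + 1) * (3 / 2) ^+ k)).
    by apply: ler_wpM2r; rewrite ?ltW // (le_lt_trans (ler_norm c)) // ltrDl.
  by rewrite -ltr_pdivlMl // mulrA [_^-1 * e]mulrC.
- have pos k : (0 < g k) = (0 < x k) by rewrite pmulr_lgt0 ?invr_gt0 // ltr0z.
  have neg k : (g k < 0) = (x k < 0) by rewrite pmulr_llt0 ?invr_gt0 // ltrz0.
  have zero k : (g k == 0) = (x k == 0).
    by rewrite mulf_eq0 invr_eq0 (gt_eqF (qn k)) orbF intr_eq0.
  have transfer (P Q : pred nat) (d : R) : P =1 Q -> has_density P d -> has_density Q d.
    by move=> /funext ->.
  by split; [exact: transfer pos dpos|exact: transfer neg dneg|exact: transfer zero dzero].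
Qed.

End InverseRoots.

(** * Signs of the coefficients of 1 / L and of their partial sums *)

Theorem theorem4p3 (R : realType) (F : finFieldType) (m : {poly F})
    (q_odd : odd #|F|) (m_monic : m \is monic) (m_sqfree : squarefree m)
    (m_deg : (2 < deg m)%N) (m_GSH : GSH R m) :
  let a_diff (k : nat) : int := (a_mu 1 k m)%:Z - (a_mu (-1) k m)%:Z in
  let A_diff (k : nat) : int := (A_mu 1 k m)%:Z - (A_mu (-1) k m)%:Z in
  [/\ has_density (fun k => 0 < a_diff k) (1 / 2 : R),
      has_density (fun k => a_diff k < 0) (1 / 2 : R) &
      has_density (fun k => a_diff k == 0) (0 : R)] /\
  [/\ has_density (fun k => 0 < A_diff k) (1 / 2 : R),
      has_density (fun k => A_diff k < 0) (1 / 2 : R) &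
      has_density (fun k => A_diff k == 0) (0 : R)].
Proof.
move=> a_diff A_diff.
have F_gt2 : (2 < #|F|)%N.
  by have := card_finNzRing_gt1 F; case: #|F| q_odd => [|[|[|]]].
have [theta [[theta_size LE] theta_indep]] := m_GSH.
(* In degree 1 or 2 there are no angles: 1 / L is 1 or 1 / (1 - u), whose coefficients never change
   sign. The bound on [deg m] provides theta_1. *)
have theta_gt0 : (0 < size theta)%N.
  by rewrite theta_size /num_angles; case: ifP => Mo; lia.
pose i0 := Ordinal theta_gt0.
pose x n : R[i] := (a_diff n)%:~R.
have Lx n : conv (Lfactored F (deg m) theta) x n = (n == 0%N)%:R.
  rewrite -(rmorph_nat (intmul 1)) -(Lcoef_conv m n) rmorph_sum /conv.
  rewrite (reindex_inj rev_ord_inj); apply: eq_bigr => i _ /=.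
  rewrite -LE /x /a_diff a_mu_diff rmorphM mulrC subSS; congr (_%:~R * _).
  by rewrite subKn // -ltnS.
have a_main : exp_main_term (inverse_root F (theta := theta)) (i0, true) (3 / 2) x.
  move: Lx; rewrite LfactoredE; case: ifP => _ Lx.
    by apply: main_term_inverse => // n; rewrite -Lx mul1r.
  (* In even degree [conv (1 - 'X) x] inverts the product over the angles, and x consists of its
     partial sums. *)
  have -> : x = fun n => \sum_(k < n.+1) conv (1 - 'X) x k.
    apply/funext => n; rewrite [LHS](geometric_unconv 1 x) scale1r.
    by apply: eq_bigr => k _; rewrite expr1n mul1r.
  apply: exp_main_term_sum; [lra|exact: inverse_root_neq1|exact: inverse_root_neq0|].
  by apply: main_term_inverse => // n; rewrite -convM mulrC.
have A_main : exp_main_term (inverse_root F (theta := theta)) (i0, true) (3 / 2)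
    (fun n => (A_diff n)%:~R).
  (* The cumulative counts start at degree 1, the partial sums of the series at degree 0. *)
  have -> : (fun n => (A_diff n)%:~R) = fun n => \sum_(k < n.+1) x k - x 0%N.
    apply/funext => n.
    have -> : A_diff n = \sum_(1 <= k < n.+1) a_diff k.
      by rewrite /A_diff /A_mu -!natz !natr_sum -sumrB; apply: eq_bigr => k _; rewrite !natz.
    rewrite -(big_mkord xpredT x) big_ltn // addrC addKr.
    exact: rmorph_sum.
  apply: exp_main_term_subC; first by lra.
  by apply: exp_main_term_sum => //; [lra|exact: inverse_root_neq1|exact: inverse_root_neq0].
by split; apply: main_term_densities; eassumption.
Qed.
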